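(* Let $H\subseteq U_n(\mathbb{F}_q)$ be an algebra group with $\dim(V_H)=d$. Let $\phi,\eta\in\mathbb{F}_q^d$, so that $x_\phi\in H$ and $\lambda_\eta\in\mathfrak{n}_H^*$ are defined according to a fixed basis of $V_H$ and its dual basis of $V_H^*$, respectively. Then $$\overline{\chi^\eta(x_\phi)}=\begin{cases}\displaystyle q^{\mathrm{corank}(\eta)-\mathrm{rank}(M_\phi^\eta)}\,\theta(b_0\cdot b_\phi^\eta)\prod_{i=1}^d\theta(\phi_i\eta_i), & \text{if $\phi$ meshes with $\eta$,}\\ 0,&\text{otherwise,}\end{cases}$$ where $b_0\in\mathbb{F}_q^d$ satisfies $M_\phi^\eta b_0=-a_\phi^\eta$, and $q^{\mathrm{corank}(\eta)}$ is the size of the right $H$-orbit of $\lambda_\eta$.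
   Context: $U_n(\mathbb{F}_q)$ is the group of $n\times n$ unipotent upper-triangular matrices over the finite field $\mathbb{F}_q$. A subgroup $H\subseteq U_n(\mathbb{F}_q)$ is an algebra group if $\mathfrak{n}_H=H-1=\{h-1\mid h\in H\}$ is an $\mathbb{F}_q$-subalgebra (not necessarily unital) of the algebra of strictly upper-triangular $n\times n$ matrices. For a function $v:\{(i,j)\mid 1\le i<j\le n\}\to\mathbb{F}_q$ let $X_v$ be the strictly upper-triangular matrix with $(i,j)$ entry $v(i,j)$. Then $V_H=\{v\mid 1+X_v\in H\}$ is an $\mathbb{F}_q$-vector space and $v\mapsto X_v$ identifies it with $\mathfrak{n}_H$. Fix a basis $\{v_1,\dots,v_d\}$ of $V_H$ and let $\{\lambda_1,\dots,\lambda_d\}$ be the dual basis of $V_H^*$. For $\phi=(\phi_1,\dots,\phi_d)\in\mathbb{F}_q^d$ put $X_\phi=\sum_{i}\phi_iX_{v_i}\in\mathfrak{n}_H$ and $x_\phi=1+X_\phi\in H$. For $\eta=(\eta_1,\dots,\eta_d)\in\mathbb{F}_q^d$ let $\lambda_\eta\in\mathfrak{n}_H^*$ be the linear functional corresponding to $\sum_i\eta_i\lambda_i$, i.e. $\lambda_\eta(X_\phi)=\sum_i\eta_i\phi_i$. $H\times H$ acts on $\mathfrak{n}_H$ by left and right multiplication; let $O_\phi=\{uX_\phi v\mid u,v\in H\}$. $H$ acts on $\mathfrak{n}_H^*$ on the right by $(\lambda v)(X)=\lambda(Xv^{-1})$, and $\mathrm{corank}(\eta)$ is defined by $q^{\mathrm{corank}(\eta)}=|\lambda_\eta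 H|$. Fix a nontrivial homomorphism $\theta:\mathbb{F}_q^+\to\mathbb{C}^\times$. The supercharacter $\chi^\eta:H\to\mathbb{C}$ is $$\chi^\eta(x_\phi)=\frac{q^{\mathrm{corank}(\eta)}}{|O_\phi|}\sum_{X\in O_\phi}\overline{\theta(\lambda_\eta(X))}.$$ Define structure constants $c_{ij}^k\in\mathbb{F}_q$ by $X_{v_i}X_{v_j}=\sum_{k=1}^d c_{ij}^kX_{v_k}$, and $d\times d$ matrices $C_i$, $C^j$ by $(C_i)_{jk}=c_{ij}^k$ and $(C^j)_{ik}=c_{ij}^k$. For $\phi,\eta\in\mathbb{F}_q^d$ (with $\phi$ treated as a row vector and $\eta$ as a column vector) let $M_\phi^\eta$ be the $d\times d$ matrix with $(M_\phi^\eta)_{ij}=\phi C_iC^j\eta$, and let $a_\phi^\eta,b_\phi^\eta\in\mathbb{F}_q^d$ be given by $(a_\phi^\eta)_i=\phi C_i\eta$, $(b_\phi^\eta)_j=\phi C^j\eta$. One says $\phi$ meshes with $\eta$ if (1) there exists $b\in\mathbb{F}_q^d$ with $M_\phi^\eta b=-a_\phi^\eta$, and (2) $b_\phi^\eta$ is perpendicular to the nullspace of $M_\phi^\eta$ (usual dot product). *)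

(* Defs.v *)
From HB Require Import structures.
From mathcomp Require Import all_boot all_order all_fingroup all_algebra all_field.

Set Implicit Arguments.
Unset Strict Implicit.
Unset Printing Implicit Defensive.

Import Order.TTheory GRing.Theory Num.Theory.
Local Open Scope ring_scope.

(* Matrices have size n.+1, the shape for which MathComp's square matrices     *)
(* form a ring.                                                               *)

Section AlgebraGroups.
Variables (F : finFieldType) (n : nat).
Implicit Type H : {group {'GL_n.+1[F]}}.

(* GLval with its codomain written 'M_n.+1 instead of 'M_n.+1.-1.+1. *)
Definition GLmx (u : {'GL_n.+1[F]}) : 'M[F]_n.+1 := GLval u.

Definition unipotent_upper : {set {'GL_n.+1[F]}} :=
  [set u | [forall i : 'I_n.+1, forall j : 'I_n.+1,
     (j <= i)%N ==> (GLmx u i j == (i == j)%:R)]].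

Definition sub1_set H : {set 'M[F]_n.+1} := [set GLmx h - 1 | h in H].

(* The closure conditions say that H - 1 is a linear subspace closed under     *)
(* products; it lies in the strictly upper triangular matrices because H is    *)
(* contained in unipotent_upper.                                              *)
Definition algebra_group H : Prop :=
  [/\ H \subset unipotent_upper,
      GRing.submod_closed (sub1_set H)
    & GRing.mulr_2closed (sub1_set H)].

Definition upper_pos := {p : 'I_n.+1 * 'I_n.+1 | (p.1 < p.2)%N}.
Definition upper_fun := {ffun upper_pos -> F^o}.

Definition upper_mx (v : upper_fun) : 'M[F]_n.+1 :=
  \matrix_(i, j) oapp v 0 (insub (i, j)).

(* The spans below turn sets that are already subspaces when H is an algebra   *)
(* group into objects of type {vspace _}: see mem_VH and mem_nH.              *)
Definition VH_set H : {set upper_fun} :=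
  [set v | [exists h in H, GLmx h == 1 + upper_mx v]].

Definition VH H : {vspace upper_fun} := <<enum (VH_set H)>>%VS.

Definition nH H : {vspace 'M[F]_n.+1} := <<enum (sub1_set H)>>%VS.

(* Value of a linear form on n_H at a matrix X belonging to n_H. *)
Definition ev H (l : 'Hom(subvs_of (nH H), F^o)) (X : 'M[F]_n.+1) : F :=
  l (vsproj (nH H) X).

Definition dual_act H (l : 'Hom(subvs_of (nH H), F^o)) (u : {'GL_n.+1[F]}) :
    'Hom(subvs_of (nH H), F^o) :=
  linfun (fun X => ev l (vsval X * GLmx u^-1%g) : F^o).

(* finvect_type is an alias that makes the space of linear forms a finType. *)
Definition dual_orbit H (l : 'Hom(subvs_of (nH H), F^o)) :
    {set finvect_type 'Hom(subvs_of (nH H), F^o)} :=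
  [set (dual_act l u : finvect_type _) | u in H].

Definition biorbit H (X : 'M[F]_n.+1) : {set 'M[F]_n.+1} :=
  [set GLmx u * X * GLmx w | u in H, w in H].

Section Consistency.
Variables (H : {group {'GL_n.+1[F]}}) (hH : algebra_group H).

Lemma mem_sub1_set X : (X \in sub1_set H) = [exists h in H, GLmx h == 1 + X].
Proof.
apply/imsetP/existsP => [[h hh ->]|[h /andP[hh /eqP e]]].
  by exists h; rewrite hh addrC subrK eqxx.
by exists h; rewrite // e addrC addKr.
Qed.

Lemma mem_nH X : (X \in nH H) = (X \in sub1_set H).
Proof.
case: hH => _ [h0 hl] _; apply/idP/idP => [|hX]; last first.
  by apply: memv_span; rewrite mem_enum.
move=> /(@coord_span _ _ _ (in_tuple _)) ->.
apply: (big_ind (fun Y => Y \in sub1_set H)) => // [Y Z hY hZ|i _].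
  by have := hl 1 Y Z hY hZ; rewrite scale1r.
rewrite -[_ *: _]addr0; apply: hl => //.
by rewrite -mem_enum; apply: mem_nth.
Qed.

Lemma upper_mx_linear : linear upper_mx.
Proof.
move=> a u w; apply/matrixP => i j; rewrite !mxE.
case: insubP => [p _ _|_] /=; last by rewrite mulr0 addr0.
by rewrite !ffunE.
Qed.

Lemma mem_VH w : (w \in VH H) = (upper_mx w \in nH H).
Proof.
case: (hH) => _ [h0 hl] _; rewrite mem_nH.
apply/idP/idP => [|hw]; last first.
  by apply: memv_span; rewrite mem_enum inE -mem_sub1_set.
move=> /(@coord_span _ _ _ (in_tuple _)) ->.
have z : upper_mx 0 = 0.
  by have := upper_mx_linear 1 0 0; rewrite !scale1r addr0 => /eqP;
     rewrite -subr_eq0 opprD addrA subrr add0r oppr_eq0 => /eqP.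
apply: (big_ind (fun Y => upper_mx Y \in sub1_set H)).
- by rewrite z.
- by move=> Y Z hY hZ; rewrite -[Y]scale1r upper_mx_linear hl.
move=> i _; rewrite -[_ *: _]addr0 upper_mx_linear z hl //.
rewrite mem_sub1_set.
set w' := nth _ _ _.
have : w' \in enum (VH_set H).
  by apply: mem_nth.
by rewrite mem_enum inE.
Qed.

Lemma upper_mx_inj : injective upper_mx.
Proof.
move=> u w /matrixP e; apply/ffunP => p; have := e (val p).1 (val p).2.
by rewrite !mxE -surjective_pairing valK.
Qed.

Lemma upper_mx_surj X : X \in nH H -> exists w, upper_mx w = X.
Proof.
rewrite mem_nH => /imsetP[h hh ->]; case: hH => /subsetP hU _ _.
exists [ffun p : upper_pos => (GLmx h - 1) (val p).1 (val p).2].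
apply/matrixP => i j; rewrite mxE; case: insubP => [p _ e|] /=.
  by rewrite ffunE e.
rewrite -leqNgt /= => hij; have := hU _ hh; rewrite inE.
by move=> /forallP/(_ i)/forallP/(_ j)/implyP/(_ hij)/eqP; rewrite !mxE => ->;
   rewrite subrr.
Qed.

End Consistency.

Section Coordinates.
Variables (d : nat) (v : d.-tuple upper_fun).

Definition basis_mx : d.-tuple 'M[F]_n.+1 := map_tuple upper_mx v.

Definition Xphi (phi : 'rV[F]_d) : 'M[F]_n.+1 :=
  \sum_i phi 0 i *: tnth basis_mx i.

(* The default value 1 is never used when H is an algebra group and v is a     *)
(* basis of V_H: see xphi_spec.                                               *)
Definition xphi (phi : 'rV[F]_d) : {'GL_n.+1[F]} := insubd (1%g : {'GL_n.+1[F]}) (1 + Xphi phi).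

(* coord basis_mx i is the i-th vector of the dual basis. *)
Definition lambda H (eta : 'cV[F]_d) : 'Hom(subvs_of (nH H), F^o) :=
  linfun (fun X => \sum_i eta i 0 * coord basis_mx i (vsval X) : F^o).

(* By card_dual_orbit the orbit has exactly #|F| ^ corank elements. *)
Definition corank H (eta : 'cV[F]_d) : nat :=
  trunc_log #|F| #|dual_orbit (lambda H eta)|.

(* The orbit O_phi is recovered from the group element x = x_phi as the        *)
(* biorbit of x - 1 = X_phi.                                                  *)
Definition superchar (C : numClosedFieldType) (theta : F -> C) H
    (eta : 'cV[F]_d) (x : {'GL_n.+1[F]}) : C :=
  (#|F| ^ corank H eta)%:R / #|biorbit H (GLmx x - 1)|%:R
  * \sum_(X in biorbit H (GLmx x - 1)) (theta (ev (lambda H eta) X))^*.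

Definition struct_const (i j k : 'I_d) : F :=
  coord basis_mx k (tnth basis_mx i * tnth basis_mx j).

Definition Cleft (i : 'I_d) : 'M[F]_d := \matrix_(j, k) struct_const i j k.
Definition Cright (j : 'I_d) : 'M[F]_d := \matrix_(i, k) struct_const i j k.

Definition Mmx (phi : 'rV[F]_d) (eta : 'cV[F]_d) : 'M[F]_d :=
  \matrix_(i, j) (phi *m Cleft i *m Cright j *m eta) 0 0.

Definition avec (phi : 'rV[F]_d) (eta : 'cV[F]_d) : 'cV[F]_d :=
  \col_i (phi *m Cleft i *m eta) 0 0.

Definition bvec (phi : 'rV[F]_d) (eta : 'cV[F]_d) : 'cV[F]_d :=
  \col_j (phi *m Cright j *m eta) 0 0.

Definition dot (a b : 'cV[F]_d) : F := \sum_i a i 0 * b i 0.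

Definition meshes (phi : 'rV[F]_d) (eta : 'cV[F]_d) : Prop :=
  (exists b : 'cV[F]_d, Mmx phi eta *m b = - avec phi eta) /\
  (forall w : 'cV[F]_d, Mmx phi eta *m w = 0 -> dot (bvec phi eta) w = 0).

End Coordinates.

Section ConsistencyBasis.
Variables (H : {group {'GL_n.+1[F]}}) (hH : algebra_group H).
Variables (d : nat) (v : d.-tuple upper_fun) (hv : basis_of (VH H) v).

Let upper_linear_mixin := GRing.isLinear.Build F upper_fun 'M[F]_n.+1 _
  upper_mx upper_mx_linear.
HB.instance Definition _ := upper_linear_mixin.

Lemma basis_mx_basis : basis_of (nH H) (basis_mx v).
Proof.
pose f : 'Hom(upper_fun, 'M[F]_n.+1) := linfun upper_mx.
have fE : f =1 upper_mx by move=> x; rewrite lfunE.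
have -> : nH H = (f @: VH H)%VS.
  apply/vspaceP => X; apply/idP/memv_imgP => [hX|[w hw ->]].
    have [w e] := upper_mx_surj hH hX.
    by exists w; rewrite ?fE ?mem_VH // e.
  by rewrite fE -mem_VH.
rewrite /basis_mx /= -(eq_map fE); apply: limg_basis_of hv.
apply/eqP; rewrite -subv0; apply/subvP => w /memv_capP[_].
rewrite memv_ker fE memv0 => /eqP e; apply/eqP/upper_mx_inj.
by rewrite e linear0.
Qed.

Lemma Xphi_nH phi : Xphi v phi \in nH H.
Proof.
apply: memv_suml => i _; apply: memvZ.
by apply: (basis_mem basis_mx_basis); apply: mem_tnth.
Qed.

Lemma xphi_spec phi : xphi v phi \in H /\ GLmx (xphi v phi) = 1 + Xphi v phi.
Proof.
have := Xphi_nH phi; rewrite mem_nH // mem_sub1_set.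
move=> /existsP[h /andP[hh /eqP e]].
have -> : xphi v phi = h by rewrite /xphi -e /GLmx valKd.
by [].
Qed.

Lemma coord_Xphi phi i : coord (basis_mx v) i (Xphi v phi) = phi 0 i.
Proof.
have /andP[_ hf] := basis_mx_basis.
rewrite /Xphi -[RHS](coord_sum_free (fun i => phi 0 i) _ hf).
by congr (coord _ _ _); apply: eq_bigr => j _; rewrite (tnth_nth 0).
Qed.

Lemma ev_lambda eta X : X \in nH H ->
  ev (lambda v H eta) X = \sum_i eta i 0 * coord (basis_mx v) i X.
Proof.
move=> hX; rewrite /ev /lambda.
pose g := fun X : subvs_of (nH H) =>
  (\sum_i eta i 0 * coord (basis_mx v) i (vsval X) : F^o).
have gl : linear g.
  move=> a Y Z; rewrite /g scaler_sumr -big_split; apply: eq_bigr => i _ /=.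
  by rewrite !linearP /= mulrDr mulrCA.
pose gm := GRing.isLinear.Build F _ F^o _ g gl.
pose gL : {linear subvs_of (nH H) -> F^o} := HB.pack g gm.
rewrite -[linfun _]/(linfun gL) lfunE.
by apply: eq_bigr => i _; rewrite vsprojK.
Qed.

Lemma ev_lambda_Xphi eta phi :
  ev (lambda v H eta) (Xphi v phi) = \sum_i eta i 0 * phi 0 i.
Proof.
rewrite ev_lambda ?Xphi_nH //.
by apply: eq_bigr => i _; rewrite coord_Xphi.
Qed.

End ConsistencyBasis.

Section ConsistencyOrbit.
Variables (H : {group {'GL_n.+1[F]}}) (hH : algebra_group H).
Implicit Type l : 'Hom(subvs_of (nH H), F^o).

Lemma nHM X Y : X \in nH H -> Y \in nH H -> X * Y \in nH H.
Proof. by rewrite !mem_nH //; case: hH => _ _ hM; apply: hM. Qed.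

Lemma nHMr X u : X \in nH H -> u \in H -> X * GLmx u \in nH H.
Proof.
move=> hX hu; rewrite -[GLmx u](subrK 1) mulrDr mulr1 rpredD // nHM //.
by rewrite mem_nH //; apply/imsetP; exists u.
Qed.

Lemma ev_linear l : linear (ev l : _ -> F^o).
Proof. by move=> a X Y; rewrite /ev !linearP. Qed.

Lemma linfun_ev_mulr l A (X : subvs_of (nH H)) :
  linfun (fun Y : subvs_of (nH H) => ev l (vsval Y * A) : F^o) X
  = ev l (vsval X * A).
Proof.
pose g := fun Y : subvs_of (nH H) => ev l (vsval Y * A) : F^o.
have gl : linear g.
  by move=> a Y Z; rewrite /g linearP /= mulrDl -scalerAl ev_linear.
pose gm := GRing.isLinear.Build F _ F^o _ g gl.
pose gL : {linear subvs_of (nH H) -> F^o} := HB.pack g gm.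
by rewrite -[linfun _]/(linfun gL) lfunE.
Qed.

Lemma ev_dual_act l u X : X \in nH H ->
  ev (dual_act l u) X = ev l (X * GLmx u^-1%g).
Proof. by move=> hX; rewrite {1}/ev linfun_ev_mulr vsprojK. Qed.

Lemma card_dual_orbit_pow l : exists r, #|dual_orbit l| = (#|F| ^ r)%N.
Proof.
pose g (B : subvs_of (nH H)) : 'Hom(subvs_of (nH H), F^o) :=
  linfun (fun X : subvs_of (nH H) => ev l (vsval X * vsval B) : F^o).
have gl : linear g.
  move=> a B B'; apply/lfunP => X.
  rewrite add_lfunE scale_lfunE !linfun_ev_mulr linearP /=.
  by rewrite mulrDr -scalerAr ev_linear.
pose gm := GRing.isLinear.Build F _ _ _ g gl.
pose gL : {linear subvs_of (nH H) -> 'Hom(subvs_of (nH H), F^o)} :=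
  HB.pack g gm.
pose G := linfun gL.
have GE B : G B = g B by rewrite lfunE.
pose W : {vspace finvect_type 'Hom(subvs_of (nH H), F^o)} := limg G.
exists (\dim W); rewrite -card_vspace.
pose t (k : finvect_type 'Hom(subvs_of (nH H), F^o)) :
  finvect_type 'Hom(subvs_of (nH H), F^o) := l + k.
have ti : injective t by move=> x y /addrI.
rewrite -(card_imset (mem W) ti); apply: eq_card => k.
apply/imsetP/imsetP => [[u hu ->]|[m hm ->]].
  have hB : GLmx u^-1%g - 1 \in nH H.
    by rewrite mem_nH //; apply/imsetP; exists u^-1%g; rewrite ?groupV.
  exists (g (vsproj (nH H) (GLmx u^-1%g - 1))).
    by rewrite -GE; apply: memv_img; apply: memvf.
  apply/lfunP => X; rewrite add_lfunE !linfun_ev_mulr vsprojK //.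
  rewrite -[in LHS](subrK 1 (GLmx _)) mulrDr mulr1 addrC.
  have := ev_linear l 1 (vsval X) (vsval X * (GLmx u^-1%g - 1)).
  by rewrite !scale1r => ->; rewrite {1}/ev vsvalK.
move: hm => /memv_imgP[B _ ->]; rewrite GE.
have := subvsP B; rewrite mem_nH // => /imsetP[u hu e].
exists u^-1%g; rewrite ?groupV //.
apply/lfunP => X; rewrite add_lfunE !linfun_ev_mulr invgK.
have a : vsval X * GLmx u = 1 *: vsval X + vsval X * (GLmx u - 1).
  by rewrite scale1r mulrBr mulr1 addrC subrK.
by rewrite e a ev_linear scale1r {2}/ev vsvalK.
Qed.

Lemma card_dual_orbit d (v : d.-tuple upper_fun) eta :
  (#|F| ^ corank v H eta)%N = #|dual_orbit (lambda v H eta)|.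
Proof.
have [r e] := card_dual_orbit_pow (lambda v H eta).
by rewrite /corank e trunc_expnK // finNzRing_gt1.
Qed.

End ConsistencyOrbit.
End AlgebraGroups.

Definition nontrivial_add_char (F : finFieldType) (C : numClosedFieldType)
    (theta : F -> C) : Prop :=
  [/\ forall x, theta x != 0,
      {morph theta : x y / x + y >-> x * y}
    & exists x, theta x != 1].

(* Main.v *)
(* Averaging [theta o lambda_eta] over the orbit [O_phi] is averaging
   [theta (lambda_eta (u X_phi w))] over all [u, w] in [H]. Writing
   [u = 1 + X_x] and [w = 1 + X_y], the argument becomes
   [phi eta + x.a + y.b + x.(M y)]; the sum over [x] forces [M y = - a], and the
   sum of [theta (y.b)] over this coset of the nullspace of [M] vanishes unless
   [b] is perpendicular to the nullspace. *)

Require Import Defs.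
From HB Require Import structures.
From mathcomp Require Import all_boot all_order all_fingroup all_algebra all_field.
From mathcomp Require Import mxabelem.

Import Order.TTheory GRing.Theory Num.Theory.
Local Open Scope ring_scope.

(** * Sums of an additive character over column vectors, nullspaces and their cosets *)

Section CharacterSums.
Set Implicit Arguments.
Unset Strict Implicit.
Variables (F : finFieldType) (C : numClosedFieldType) (theta : F -> C).
Hypothesis htheta : nontrivial_add_char theta.

Lemma add_char0 : theta 0 = 1.
Proof.
have [nz tD _] := htheta.
by apply: (mulfI (nz 0)); rewrite -tD addr0 mulr1.
Qed.

Lemma add_char_sum (I : finType) (f : I -> F) :
  theta (\sum_i f i) = \prod_i theta (f i).
Proof.
have [_ tD _] := htheta.
by apply: (big_morph theta tD add_char0).
Qed.

(** Translating by [w] permutes [W] and multiplies the sum by [psi w], which is not 1. Asking only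
    that [W] be stable under this one translation covers both the whole space and a nullspace. *)
Lemma character_sum_eq0 (V : finZmodType) (W : {pred V}) (psi : V -> C) (w : V) :
  {morph psi : x y / x + y >-> x * y} ->
  (forall x, (x + w \in W) = (x \in W)) -> psi w != 1 ->
  \sum_(x in W) psi x = 0.
Proof.
move=> psiD Ww psiw.
have : \sum_(x in W) psi x = (\sum_(x in W) psi x) * psi w.
  rewrite mulr_suml (reindex (+%R^~ w)) /=; last first.
    by exists (fun x => x - w) => x _; rewrite ?addrK ?subrK.
  by apply: eq_big => [x|x _]; rewrite ?Ww ?psiD.
move/eqP; rewrite -subr_eq0 -{1}[\sum_(x in W) _]mulr1 -mulrBr mulf_eq0.
by rewrite subr_eq0 [1 == _]eq_sym (negPf psiw) orbF => /eqP.
Qed.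

Lemma dotDl d (x y c : 'cV[F]_d) : dot (x + y) c = dot x c + dot y c.
Proof.
by rewrite /dot -big_split; apply: eq_bigr => i _; rewrite !mxE mulrDl.
Qed.

Lemma dotZl d a (x c : 'cV[F]_d) : dot (a *: x) c = a * dot x c.
Proof.
by rewrite /dot mulr_sumr; apply: eq_bigr => i _; rewrite !mxE mulrA.
Qed.

Lemma dotC d (x y : 'cV[F]_d) : dot x y = dot y x.
Proof. by apply: eq_bigr => i _; rewrite mulrC. Qed.

Lemma dot_mx d (x y : 'cV[F]_d) : dot x y = (x^T *m y) 0 0.
Proof. by rewrite mxE; apply: eq_bigr => i _; rewrite !mxE. Qed.

Lemma add_char_dotD d (c : 'cV[F]_d) :
  {morph (fun x => theta (dot x c)) : x y / x + y >-> x * y}.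
Proof. by have [_ tD _] := htheta; move=> x y; rewrite /= dotDl tD. Qed.

(** A functional that is nonzero at [w] takes every value on the line through [w], including one
    where [theta] is not 1. *)
Lemma add_char_dot_neq1 d (c w : 'cV[F]_d) :
  dot w c != 0 -> exists t : F, theta (dot (t *: w) c) != 1.
Proof.
have [_ _ [t ht]] := htheta => hw; exists (t / dot w c).
by rewrite dotZl divfK.
Qed.

(** Orthogonality of characters: for nonzero [c], the basis vector at a nonzero coordinate of [c]
    gives a line on which the character is nontrivial. The boolean [c == 0] serves as the number 0
    or 1. *)
Lemma sum_add_char_dot d (c : 'cV[F]_d) :
  \sum_(x : 'cV[F]_d) theta (dot x c) = ((c == 0) * #|F| ^ d)%:R.
Proof.
have [->|] := eqVneq c 0.
  rewrite mul1n (eq_bigr (fun=> 1)) => [|x _].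
    by rewrite sumr_const card_mx muln1.
  by rewrite dot_mx mulmx0 mxE add_char0.
move=> c0; have /existsP[i ci] : [exists i, c i 0 != 0].
  apply: contraNT c0; rewrite negb_exists => /forallP c0.
  by apply/eqP/colP => i; rewrite mxE; apply/eqP; rewrite -[_ == _]negbK.
have : dot (delta_mx i 0) c != 0.
  by rewrite dot_mx trmx_delta -rowE mxE.
case/add_char_dot_neq1 => t ht.
by apply: character_sum_eq0 ht => //; apply: add_char_dotD.
Qed.

(** [kermx] is a left kernel, made of rows, so the column nullspace of [M] is transposed into the
    left kernel of the transpose of [M]. *)
Lemma card_ker_mx d (M : 'M[F]_d) :
  #|[set w : 'cV[F]_d | M *m w == 0]| = (#|F| ^ (d - \rank M))%N.
Proof.
rewrite -(mxrank_tr M) -mxrank_ker -card_rowg.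
rewrite -(card_imset _ (@trmx_inj F d 1)); apply: eq_card => u.
rewrite mem_rowg sub_kermx; apply/imsetP/idP => [[w]|hu].
  by rewrite inE => /eqP hw ->; rewrite -trmx_mul hw trmx0.
exists u^T; rewrite ?trmxK // inE.
by rewrite -trmx_eq0 trmx_mul trmxK.
Qed.

(** The solutions of [a + M *m x = 0] form the coset of the nullspace through [b0], and translation
    by [b0] pulls out one factor. *)
Lemma sum_affine_add_char d (M : 'M[F]_d) (a b : 'cV[F]_d) (b0 : 'cV[F]_d) :
  M *m b0 = - a ->
  \sum_(x : 'cV[F]_d | a + M *m x == 0) theta (dot x b) =
  theta (dot b0 b) * \sum_(w in [set w | M *m w == 0]) theta (dot w b).
Proof.
move=> hb0; rewrite (reindex (+%R b0)) /=; last first.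
  by exists (+%R (- b0)) => x _; rewrite ?addKr ?addNKr.
rewrite mulr_sumr; apply: eq_big => [x|x _].
  by rewrite inE mulmxDr hb0 addNKr.
exact: add_char_dotD.
Qed.

Lemma sum_bilinear_add_char d (M : 'M[F]_d) (a b : 'cV[F]_d) :
  \sum_(x : 'cV[F]_d) \sum_(y : 'cV[F]_d)
    theta (dot x a + dot y b + dot x (M *m y)) =
  (#|F| ^ d)%:R * \sum_(y : 'cV[F]_d | a + M *m y == 0) theta (dot y b).
Proof.
have [_ tD _] := htheta.
rewrite exchange_big mulr_sumr [RHS]big_mkcond; apply: eq_bigr => y _ /=.
(* For fixed [y] the terms in [x] combine into the dot product of [x] with [a + M *m y], so
   orthogonality applies to the sum over [x]. *)
under eq_bigr => x _ do
  rewrite addrAC -[dot x a]dotC -[dot x (M *m y)]dotC -dotDl dotC tD.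
rewrite -mulr_suml sum_add_char_dot.
by case: eqP => _; rewrite ?mul1n ?mul0r.
Qed.

End CharacterSums.

(** * Averages over a two-sided orbit as averages over pairs of group elements *)

Section Biorbit.
Set Implicit Arguments.
Unset Strict Implicit.
Variables (gT : finGroupType) (G : {group gT}) (R : finNzRingType).
Variables (r : gT -> R) (C : numFieldType) (X : R).
Hypothesis r1 : r 1%g = 1.
Hypothesis rM : {morph r : x y / (x * y)%g >-> x * y}.

Let orbit2 := [set r u * X * r w | u in G, w in G].

Let fiber Y := [set p in setX G G | r p.1 * X * r p.2 == Y].

Let in_fiber Y u w :
  ((u, w) \in fiber Y) = [&& u \in G, w \in G & r u * X * r w == Y].
Proof. by rewrite inE in_setX andbA. Qed.

(** For [Y = r u * X * r w], the map sending [(p, q)] to [(u * p, q * w)] is a bijection from the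
    fiber over [X], the stabilizer of [X], onto the fiber over [Y]. *)
Lemma card_orbit2_fiber Y : Y \in orbit2 -> #|fiber Y| = #|fiber X|.
Proof.
case/imset2P => u w hu hw ->.
pose t (p : gT * gT) := (u * p.1, p.2 * w)%g.
have ti : injective t by move=> [p q] [p' q'] [/mulgI -> /mulIg ->].
rewrite -[RHS](card_imset _ ti); apply: eq_card => -[p q].
apply/idP/imsetP => [|[[p' q']]]; rewrite in_fiber => /and3P[hp hq /eqP e].
  exists (u^-1 * p, q * w^-1)%g; last by rewrite /t mulKVg mulgKV.
  rewrite in_fiber !groupM ?groupV // !rM.
  have -> : r u^-1%g * r p * X * (r q * r w^-1%g) =
            r u^-1%g * (r p * X * r q) * r w^-1%g.
    by rewrite !mulrA.
  rewrite e !mulrA -rM mulVg r1 mul1r.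
  by rewrite -mulrA -rM mulgV r1 mulr1 eqxx.
case=> -> ->; rewrite in_fiber !groupM // !rM.
by rewrite -[X in _ == _ * X * _]e !mulrA eqxx.
Qed.

Lemma sum_orbit2 (f : R -> C) :
  \sum_(u in G) \sum_(w in G) f (r u * X * r w) =
  #|fiber X|%:R * \sum_(Y in orbit2) f Y.
Proof.
rewrite pair_big /= mulr_sumr.
rewrite (partition_big (fun p => r p.1 * X * r p.2) (mem orbit2)) /=; last first.
  by move=> [u w] /andP[hu hw]; apply/imset2P; exists u w.
apply: eq_bigr => Y hY.
rewrite -(card_orbit2_fiber hY) mulr_natl -sumr_const.
apply: eq_big => [[u w]|[u w]]; first by rewrite in_fiber andbA.
by case/andP => _ /eqP <-.
Qed.

Lemma average_orbit2 (f : R -> C) :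
  (#|orbit2|%:R)^-1 * \sum_(Y in orbit2) f Y =
  #|G|%:R ^- 2 * \sum_(u in G) \sum_(w in G) f (r u * X * r w).
Proof.
(* The constant function 1 yields the orbit-counting identity: the fiber size times the orbit size
   is the square of the order of [G]. *)
have := sum_orbit2 (fun=> 1); rewrite sum_orbit2.
set c := #|_|%:R; rewrite !sumr_const => e.
have G0 : #|G|%:R != 0 :> C by rewrite pnatr_eq0 -lt0n cardG_gt0.
have {}e : c * #|orbit2|%:R = #|G|%:R ^+ 2.
  by rewrite -e expr2 mulr_natr.
have : c * #|orbit2|%:R != 0 by rewrite e expf_neq0.
rewrite -e mulf_eq0 negb_or => /andP[c0 o0].
by rewrite invfM mulrACA mulVf ?mul1r.
Qed.

End Biorbit.

(** * Coordinates on the algebra group and the value of the functional along the orbit *)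

Section Coordinates.
Set Implicit Arguments.
Unset Strict Implicit.
Variables (F : finFieldType) (n d : nat) (H : {group {'GL_n.+1[F]}}).
Hypothesis hH : algebra_group H.
Variables (v : d.-tuple (upper_fun F n)).
Hypothesis hv : basis_of (VH H) v.
Implicit Types (phi psi : 'rV[F]_d) (eta : 'cV[F]_d) (i j k : 'I_d).

Lemma XphiK Y : Y \in nH H -> Xphi v (\row_i coord (basis_mx v) i Y) = Y.
Proof.
move=> hY; rewrite [RHS](coord_basis (basis_mx_basis hH hv) hY).
by apply: eq_bigr => i _; rewrite mxE (tnth_nth 0).
Qed.

Lemma Xphi_inj : injective (Xphi v).
Proof.
move=> phi psi e; apply/rowP => i.
by rewrite -(coord_Xphi hH hv phi) e (coord_Xphi hH hv).
Qed.

Lemma mem_basis_nH i : tnth (basis_mx v) i \in nH H.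
Proof. by apply: (basis_mem (basis_mx_basis hH hv)); apply: mem_tnth. Qed.

Lemma basis_mul_Xphi phi i :
  tnth (basis_mx v) i * Xphi v phi = Xphi v (phi *m Cleft v i).
Proof.
rewrite -[LHS]XphiK; last by rewrite nHM ?mem_basis_nH ?Xphi_nH.
congr Xphi; apply/rowP => k; rewrite !mxE mulr_sumr linear_sum.
by apply: eq_bigr => j _; rewrite -scalerAr linearZ mxE.
Qed.

Lemma Xphi_mul_basis phi j :
  Xphi v phi * tnth (basis_mx v) j = Xphi v (phi *m Cright v j).
Proof.
rewrite -[LHS]XphiK; last by rewrite nHM ?mem_basis_nH ?Xphi_nH.
congr Xphi; apply/rowP => k; rewrite !mxE mulr_suml linear_sum.
by apply: eq_bigr => i _; rewrite -scalerAl linearZ mxE.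
Qed.

Section Functional.
Variables (phi : 'rV[F]_d) (eta : 'cV[F]_d).
Let l := lambda v H eta.
(** Makes the generic lemmas on linear maps available for [ev l]. *)
HB.instance Definition _ :=
  GRing.isLinear.Build F 'M[F]_n.+1 F^o _ (ev l) (ev_linear l).

Lemma ev_lambda_Xphi_mx psi : ev l (Xphi v psi) = (psi *m eta) 0 0.
Proof.
rewrite ev_lambda_Xphi // mxE.
by apply: eq_bigr => i _; rewrite mulrC.
Qed.

Lemma ev_mul_left (x : 'cV[F]_d) :
  ev l (Xphi v x^T * Xphi v phi) = dot x (avec v phi eta).
Proof.
rewrite mulr_suml linear_sum; apply: eq_bigr => i _ /=.
by rewrite -scalerAl linearZ /= basis_mul_Xphi ev_lambda_Xphi_mx !mxE.
Qed.

Lemma ev_mul_right (y : 'cV[F]_d) :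
  ev l (Xphi v phi * Xphi v y^T) = dot y (bvec v phi eta).
Proof.
rewrite mulr_sumr linear_sum; apply: eq_bigr => i _ /=.
by rewrite -scalerAr linearZ /= Xphi_mul_basis ev_lambda_Xphi_mx !mxE.
Qed.

(** Left multiplication by the [i]-th basis vector acts on coordinates through [Cleft i], then right
    multiplication by the [j]-th through [Cright j]. Pairing with [eta] gives exactly the entry of
    [Mmx] at [i], [j]. *)
Lemma ev_mul_both (x y : 'cV[F]_d) :
  ev l (Xphi v x^T * Xphi v phi * Xphi v y^T) = dot x (Mmx v phi eta *m y).
Proof.
rewrite mulr_suml mulr_suml linear_sum; apply: eq_bigr => i _ /=.
rewrite -!scalerAl linearZ basis_mul_Xphi /=; congr (_ * _).
  by rewrite mxE.
rewrite mulr_sumr linear_sum [RHS]mxE; apply: eq_bigr => j _ /=.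
rewrite -scalerAr linearZ /= Xphi_mul_basis ev_lambda_Xphi_mx.
by rewrite !mxE mulrC.
Qed.

Lemma ev_biaction (x y : 'cV[F]_d) :
  ev l (GLmx (xphi v x^T) * Xphi v phi * GLmx (xphi v y^T)) =
  (phi *m eta) 0 0 + (dot x (avec v phi eta) + dot y (bvec v phi eta)
    + dot x (Mmx v phi eta *m y)).
Proof.
rewrite !(xphi_spec hH hv _).2 mulrDl mul1r mulrDr mulr1 mulrDl.
rewrite !linearD /= ev_lambda_Xphi_mx ev_mul_left ev_mul_right ev_mul_both.
by rewrite -!addrA; congr (_ + _); congr (_ + _).
Qed.

End Functional.

(** First half of the parametrization of [H] by column vectors. Columns are used because [avec],
    [bvec] and [Mmx] live on that side, whereas [xphi] takes rows; hence the transposes. *)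
Lemma xphi_tr_inj : injective (fun x : 'cV[F]_d => xphi v x^T).
Proof.
move=> x y e; apply: trmx_inj; apply: Xphi_inj; apply: (@addrI _ 1).
by rewrite -!(xphi_spec hH hv _).2 e.
Qed.

Lemma xphi_tr_image : [set xphi v x^T | x : 'cV[F]_d] = H.
Proof.
apply/setP => u; apply/imsetP/idP => [[x _ ->]|hu].
  exact: (xphi_spec hH hv _).1.
have hX : GLmx u - 1 \in nH H.
  by rewrite mem_nH //; apply/imsetP; exists u.
exists (\row_i coord (basis_mx v) i (GLmx u - 1))^T => //.
have := (xphi_spec hH hv (\row_i coord (basis_mx v) i (GLmx u - 1))).2.
by rewrite XphiK // [1 + _]addrC subrK trmxK => e; apply: val_inj; apply: esym e.
Qed.

Lemma sum_group (R : nmodType) (f : {'GL_n.+1[F]} -> R) :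
  \sum_(u in H) f u = \sum_(x : 'cV[F]_d) f (xphi v x^T).
Proof.
rewrite -{1}xphi_tr_image big_imset //=.
by move=> x y _ _; apply: xphi_tr_inj.
Qed.

Lemma card_algebra_group : #|H| = (#|F| ^ d)%N.
Proof.
by rewrite -xphi_tr_image card_imset ?card_mx ?muln1 //; apply: xphi_tr_inj.
Qed.

(** Reduces the character value to a sum over the solutions of one linear system, before any
    assumption that a solution exists. *)
Lemma conj_superchar (C : numClosedFieldType) (theta : F -> C)
    (htheta : nontrivial_add_char theta) phi eta :
  (superchar v theta H eta (xphi v phi))^* =
  (#|F| ^ corank v H eta)%:R / (#|F| ^ d)%:R * theta ((phi *m eta) 0 0) *
  \sum_(y : 'cV[F]_d | avec v phi eta + Mmx v phi eta *m y == 0)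
    theta (dot y (bvec v phi eta)).
Proof.
have [_ tD _] := htheta.
have q0 : (#|F| ^ d)%:R != 0 :> C.
  by rewrite -card_algebra_group pnatr_eq0 -lt0n cardG_gt0.
rewrite /superchar (xphi_spec hH hv _).2 addrC addKr.
rewrite !rmorphM fmorphV !rmorph_nat rmorph_sum /=.
under eq_bigr do rewrite conjCK.
rewrite -mulrA.
(* The orbit average becomes an average over pairs in [H]; [GLmx] respects units and products by
   computation. *)
rewrite (@average_orbit2 _ H _ (@GLmx F n) C _ (erefl _) (fun _ _ => erefl _)).
rewrite card_algebra_group.
under [X in _ * (_ * X)]eq_bigr => u _ do rewrite sum_group.
rewrite sum_group.
under [X in _ * (_ * X)]eq_bigr => x _.
  under eq_bigr => y _ do rewrite ev_biaction tD.
  rewrite -mulr_sumr; over.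
rewrite -mulr_sumr sum_bilinear_add_char // -!mulrA; congr (_ * _).
(* Of the two factors [#|F| ^ d] in the denominator, one cancels against the factor produced by the
   sum over [x]. *)
rewrite expr2 invfM -mulrA; congr (_ * _).
by rewrite mulrCA; congr (_ * _); rewrite mulKf.
Qed.

End Coordinates.

(** * Evaluation of the remaining coset sum according to meshing *)

Theorem theorem6p1 (F : finFieldType) (n d : nat)
    (H : {group {'GL_n.+1[F]}}) (hH : algebra_group H)
    (hd : \dim (VH H) = d)
    (v : d.-tuple (upper_fun F n)) (hv : basis_of (VH H) v)
    (C : numClosedFieldType) (theta : F -> C)
    (htheta : nontrivial_add_char theta)
    (phi : 'rV[F]_d) (eta : 'cV[F]_d) :
  (meshes v phi eta ->
   forall b0 : 'cV[F]_d, Mmx v phi eta *m b0 = - avec v phi eta ->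
   (superchar v theta H eta (xphi v phi))^* =
     (#|F|%:R : C) ^ ((corank v H eta)%:Z - (\rank (Mmx v phi eta))%:Z)
     * theta (dot b0 (bvec v phi eta))
     * \prod_(i < d) theta (phi 0 i * eta i 0)) /\
  (~ meshes v phi eta ->
   (superchar v theta H eta (xphi v phi))^* = 0).
Proof.
rewrite (conj_superchar hH hv htheta).
set M := Mmx v phi eta; set a := avec v phi eta; set b := bvec v phi eta.
split=> [[_ perp] b0 hb0|nmesh].
  rewrite (sum_affine_add_char htheta b hb0).
  (* Perpendicularity makes every term on the nullspace equal to 1, so the sum is the size of the
     nullspace. *)
  rewrite (eq_bigr (fun=> 1)) => [|w]; last first.
    by rewrite inE dotC => /eqP/perp ->; rewrite (add_char0 htheta).
  rewrite sumr_const card_ker_mx -(add_char_sum htheta).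
  have -> : \sum_i phi 0 i * eta i 0 = (phi *m eta) 0 0 by rewrite mxE.
  have q0 : #|F|%:R != 0 :> C.
    by rewrite pnatr_eq0 -lt0n; apply/card_gt0P; exists 0.
  have qd0 : #|F|%:R ^+ d != 0 :> C by rewrite expf_neq0.
  rewrite expfzDr // -exprnP -exprnN !natrX.
  (* The size of the nullspace divided by [#|F| ^ d] is the negative power of the rank; the natural
     subtraction is exact because the rank is at most [d]. *)
  have -> : #|F|%:R ^- \rank M = #|F|%:R ^+ (d - \rank M) / #|F|%:R ^+ d :> C.
    have e : #|F|%:R ^+ (d - \rank M) * #|F|%:R ^+ \rank M = #|F|%:R ^+ d :> C.
      by rewrite -exprD subnK ?rank_leq_row.
    apply: (mulIf qd0); rewrite divfK // -[X in _ * X]e.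
    by rewrite mulrCA mulVf ?mulr1 // expf_neq0.
  rewrite -exprVn -!mulrA; congr (_ * _); rewrite [RHS]mulrCA; congr (_ * _).
  by rewrite mulrA [LHS]mulrC [X in _ * X]mulrC.
(* Meshing fails in two ways: either the system is solvable and perpendicularity fails, or it has no
   solution and the sum is empty. *)
have [[b0 /eqP hb0]|nb0] := altP (@existsP _ (fun x => M *m x == - a)).
  rewrite (sum_affine_add_char htheta b hb0).
  have [w] : exists w, (M *m w == 0) && (dot w b != 0).
    apply/existsP; apply: contra_notT nmesh; rewrite negb_exists.
    move=> /forallP hw; split; first by exists b0.
    by move=> w /eqP Mw; have := hw w; rewrite Mw negbK dotC => /eqP.
  (* A multiple of the nullspace vector [w] has character value different from 1, and translation by
     it preserves the nullspace, so the sum vanishes. *)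
  case/andP => /eqP Mw /(add_char_dot_neq1 htheta)[t ht].
  rewrite (character_sum_eq0 (add_char_dotD htheta b) _ ht) ?mulr0 // => x.
  by rewrite !inE mulmxDr -scalemxAr Mw scaler0 addr0.
rewrite big_pred0 ?mulr0 // => y; apply: contraNF nb0 => /eqP e.
by apply/existsP; exists y; rewrite -addr_eq0 addrC e.
Qed.
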